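(* Let $\nu,\mu$ be computable probability measures on Cantor space $2^{\mathbb{N}}$ with full support. If $\nu\ll_{kl}\mu$, then $\nu \ll_{\mathsf{MLR}} \mu$.
   Context: A probability measure $\nu$ on Cantor space is identified with the function $\sigma\mapsto\nu(\sigma):=\nu([\sigma])$ on $2^{<\mathbb{N}}$, where $[\sigma]$ is the set of $\omega\in 2^{\mathbb{N}}$ extending $\sigma$. It is computable if the reals $\nu(\sigma)$ are computable uniformly in $\sigma$; it has full support if $\nu(\sigma)>0$ for all $\sigma$. $\omega\upharpoonright n$ is the length-$n$ initial segment of $\omega$. $\nu\ll_{kl}\mu$ iff $\sup_n \mathbb{E}_{\nu}\ln\frac{\nu(\cdot\upharpoonright n)}{\mu(\cdot\upharpoonright n)}$ (expectation of $\omega\mapsto \ln\frac{\nu(\omega\upharpoonright n)}{\mu(\omega\upharpoonright n)}$) is finite. A c.e. open set is one of the form $\bigcup_n[\sigma_n]$ for a computable sequence $\sigma_n$ of binary strings. $\mathsf{MLR}^{\nu}$ (Martin-Löf $\nu$-random points) is the set of $\omega$ such that $\omega\notin\bigcap_n U_n$ for every computable sequence $U_n$ of c.e. opens with $\nu(U_n)\le 2^{-n}$ for all $n\ge 0$. $\nu\ll_{\mathsf{MLR}}\mu$ means $\mathsf{MLR}^{\nu}\subseteq\mathsf{MLR}^{\mu}$. *)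

(* Defs.v *)
From HB Require Import structures.
From mathcomp Require Import all_boot all_order all_algebra.
From mathcomp Require Import all_classical all_reals all_analysis.

Set Implicit Arguments.
Unset Strict Implicit.
Unset Printing Implicit Defensive.

Import Order.TTheory GRing.Theory Num.Theory.

Local Open Scope classical_set_scope.
Local Open Scope ring_scope.

(* Total recursive functions of several natural-number variables: the least
   class containing the initial functions and closed under composition,
   primitive recursion and minimization.  Minimization is applied only when it
   is everywhere defined; by Kleene's normal form theorem this gives exactly
   the total functions computable by a Turing machine. *)
Inductive recursive : forall k : nat, (k.-tuple nat -> nat) -> Prop :=
| rec_zero k : recursive (fun _ : k.-tuple nat => 0%N)
| rec_succ : recursive (fun v : 1.-tuple nat => (thead v).+1)
| rec_proj k (i : 'I_k) : recursive (fun v : k.-tuple nat => tnth v i)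
| rec_comp k m (f : m.-tuple nat -> nat) (g : 'I_m -> k.-tuple nat -> nat) :
    recursive f -> (forall i, recursive (g i)) ->
    recursive (fun v => f [tuple g i v | i < m])
| rec_primrec k (f : k.-tuple nat -> nat) (g : k.+2.-tuple nat -> nat)
    (h : k.+1.-tuple nat -> nat) :
    recursive f -> recursive g ->
    (forall v, h (cons_tuple 0%N v) = f v) ->
    (forall n v, h (cons_tuple n.+1 v) =
                 g (cons_tuple n (cons_tuple (h (cons_tuple n v)) v))) ->
    recursive h
| rec_min k (f : k.+1.-tuple nat -> nat) (h : k.-tuple nat -> nat) :
    recursive f ->
    (forall v, f (cons_tuple (h v) v) = 0%N) ->
    (forall v y, (y < h v)%N -> f (cons_tuple y v) <> 0%N) ->
    recursive h.

Definition recursive2 (f : nat -> nat -> nat) : Prop :=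
  recursive (fun v : 2.-tuple nat => f (tnth v ord0) (tnth v ord_max)).

(* Bijective base-2 numeration (least significant digit first, digits 1 and 2
   for false and true), an effective bijection from binary strings to nat. *)
Fixpoint code (s : seq bool) : nat :=
  if s is b :: s' then ((code s').*2 + b).+1 else 0%N.

Lemma code_inj : injective code.
Proof.
elim=> [|b s IH] [|c t] //= [E].
have Eb : b = c.
  by move: (congr1 odd E); rewrite !oddD !odd_double; case: b c {E} => [] [].
by move: E; rewrite Eb => /addIn /double_inj /IH ->.
Qed.

Lemma code_surj n : exists s, code s = n.
Proof.
elim/ltn_ind: n => -[|n] IH; first by exists [::].
have [|s Es] := IH n./2; first by rewrite ltnS leq_half_double -addnn -addnS leq_addr.
by exists (odd n :: s); rewrite /= Es addnC odd_double_half.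
Qed.

Definition computable_strings2 (s : nat -> nat -> seq bool) : Prop :=
  recursive2 (fun n k => code (s n k)).

(* Computability of reals x_s, uniformly in the string s: from s and n one
   computes a rational (p - m) / (q + 1) within 2^-n of x_s. *)
Definition computable_reals (R : realType) (x : seq bool -> R) : Prop :=
  exists p m q : nat -> nat -> nat,
    [/\ recursive2 p, recursive2 m, recursive2 q &
      forall (s : seq bool) (n : nat),
        `| x s - ((p (code s) n)%:R - (m (code s) n)%:R)
                 / (q (code s) n).+1%:R | <= 2^-1 ^+ n].

(* Cantor space with the Borel sigma-algebra of its product topology. *)
Notation cantor := (g_sigma_algebraType (@open cantor_space)).

Definition restr (w : cantor) (n : nat) : seq bool :=
  mkseq (fun i => w i) n.

Definition cylinder (s : seq bool) : set cantor :=
  [set w | restr w (size s) = s].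

Lemma cylinder_measurable (s : seq bool) : measurable (cylinder s).
Proof.
apply: sub_sigma_algebra.
have -> : cylinder s = \big[setI/setT]_(i < size s)
    [set w : cantor_space | w i = nth false s i].
  rewrite -(bigcap_mkord _ (fun i (w : cantor_space) => w i = nth false s i)); apply/seteqP; split => w.
    rewrite /cylinder /restr /= => E i /= lti.
    by rewrite -[in RHS]E nth_mkseq.
  move=> /= H; apply: (@eq_from_nth _ false); rewrite size_mkseq // => i lti.
  by rewrite nth_mkseq //; exact: (H i lti).
apply: big_ind; [exact: openT|exact: openI|move=> i _].
apply: (@open_comp _ _ (fun w : cantor_space => w i) [set nth false s i]); last exact: discrete_open.
by move=> w _; exact: (@proj_continuous nat (fun=> bool) i w).
Qed.

Section Measures.
Context {R : realType}.
Implicit Types nu mu : probability cantor R.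

Definition mass nu (s : seq bool) : R := fine (nu (cylinder s)).

Definition computable_measure nu : Prop := computable_reals (mass nu).

Definition full_support nu : Prop := forall s, 0 < mass nu s.

Definition kl_ac nu mu : Prop :=
  ereal_sup (range (fun n : nat =>
    ('E_nu[fun w => ln (mass nu (restr w n) / mass mu (restr w n))])%E))
  \is a fin_num.

Definition computable_ce_opens (U : nat -> set cantor) : Prop :=
  exists2 s : nat -> nat -> seq bool,
    computable_strings2 s & forall n, U n = \bigcup_k cylinder (s n k).

Definition ml_test nu (U : nat -> set cantor) : Prop :=
  computable_ce_opens U /\ forall n, (nu (U n) <= (2^-1 ^+ n)%:E)%E.

Definition MLR nu : set cantor :=
  [set w | forall U, ml_test nu U -> ~ (\bigcap_n U n) w].

Definition mlr_ac nu mu : Prop := MLR nu `<=` MLR mu.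

End Measures.

(* Main.v *)
(* If all finite-level divergences of nu from mu are at most D, then the
   variational lower bound for the Kullback-Leibler divergence, tested against
   n ln 2 times the indicator of A, gives n ln 2 * nu(A) <= D + 1 for every
   clopen A with mu(A) <= 2^-n, and by continuity from below for every open
   such A.  So nu(U_n) = O(1/n) for each mu-test (U_n), and the computable
   subsequence U_(K 2^n) is a nu-test for K large. *)
Require Import Defs.
From mathcomp Require Import all_boot all_order all_algebra.
From mathcomp Require Import all_classical all_reals all_analysis.
From mathcomp Require Import ring lra.

Import Order.TTheory GRing.Theory Num.Theory.
Local Open Scope classical_set_scope.
Local Open Scope ring_scope.

(** * Closure properties of recursive functions *)

Lemma eq_recursive k (f g : k.-tuple nat -> nat) :
  f =1 g -> recursive f -> recursive g.
Proof. by move=> /funext ->. Qed.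

Lemma recursive_comp1 {k} (f : nat -> nat) (g : k.-tuple nat -> nat) :
  recursive (fun v : 1.-tuple nat => f (thead v)) -> recursive g ->
  recursive (fun v => f (g v)).
Proof.
move=> rf rg.
apply: eq_recursive (@rec_comp k 1 _ (fun _ v => g v) rf (fun _ => rg)) => v.
by rewrite /thead tnth_mktuple.
Qed.

Lemma recursive_cst k (c : nat) : recursive (fun _ : k.-tuple nat => c).
Proof.
elim: c => [|c IH]; first exact: rec_zero.
exact: (recursive_comp1 succn _ rec_succ IH).
Qed.

Lemma recursive_iter (f : nat -> nat) (c : nat) :
  recursive (fun v : 1.-tuple nat => f (thead v)) ->
  recursive (fun v : 1.-tuple nat => iter (thead v) f c).
Proof.
(* The step function of [rec_primrec] receives the counter at index 0 and the previous value at
   index 1; only the latter, [lift ord0 ord0], is fed to [f]. *)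
move=> rf; apply: (@rec_primrec 0 (fun=> c)
  (fun v : 2.-tuple nat => f (tnth v (lift ord0 ord0)))).
- exact: recursive_cst.
- by apply: recursive_comp1 => //; exact: rec_proj.
- by move=> v; rewrite theadE.
- by move=> n v; rewrite !theadE.
Qed.

(** Two nested iterations suffice: doubling iterates [n.+2] from 0, and doubling is then iterated
    from [c]. This makes the index sequence of the final test computable. *)
Lemma recursive_mul_expn2 (c : nat) :
  recursive (fun v : 1.-tuple nat => (c * 2 ^ thead v)%N).
Proof.
have rdbl : recursive (fun v : 1.-tuple nat => (thead v).*2).
  apply: eq_recursive (recursive_iter (fun n => n.+2) 0
    (recursive_comp1 succn _ rec_succ rec_succ)) => v /=.
  by elim: (thead v) => //= n ->; rewrite doubleS.
apply: eq_recursive (recursive_iter double c rdbl) => v /=.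
elim: (thead v) => [|n IH]; first by rewrite /= muln1.
by rewrite iterS IH expnS mulnCA mul2n.
Qed.

(** Needed so that a computable subsequence of a computable sequence of c.e. opens is again
    computable. *)
Lemma recursive2_compl (F : nat -> nat -> nat) (g : nat -> nat) :
  recursive2 F -> recursive (fun v : 1.-tuple nat => g (thead v)) ->
  recursive2 (fun n k => F (g n) k).
Proof.
move=> rF rg.
pose G (i : 'I_2) (v : 2.-tuple nat) :=
  if i == ord0 then g (tnth v ord0) else tnth v ord_max.
have rG i : recursive (G i).
  rewrite /G; case: (i == ord0); last exact: rec_proj.
  by apply: (recursive_comp1 g) => //; exact: rec_proj.
apply: eq_recursive (rec_comp rF rG) => v.
by rewrite !tnth_mktuple.
Qed.

(** * Relative entropy on a finite set *)

Section KullbackLeibler.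
Context {R : realType}.

(* [ln x <= x - 1] at [x = c * q / p]. *)
Lemma ln_ratio_ge (p q c : R) : 0 < p -> 0 < q -> 0 < c ->
  ln c * p + p - c * q <= ln (p / q) * p.
Proof.
move=> p0 q0 c0.
have x0 : 0 < c * q / p by rewrite divr_gt0 // mulr_gt0.
have lnx : ln (c * q / p) <= c * q / p - 1.
  have := @le_ln1Dx R (c * q / p - 1); rewrite addrCA subrr addr0; apply.
  by rewrite ltrBrDl subrr.
have E : ln (c * q / p) = ln c - ln (p / q).
  by rewrite -mulrA -(invf_div p) lnM ?posrE ?invr_gt0 ?divr_gt0 // lnV ?posrE ?divr_gt0.
have := ler_wpM2r (ltW p0) lnx.
rewrite E mulrBl [(_ / _ - 1) * _]mulrBl divfK ?gt_eqF // mul1r; lra.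
Qed.

(** This is the variational bound in linearised form: sum [ln_ratio_ge] over [T] with a weight [c]
    that depends on [t]. The additive 1 is the bound 2 on the [q]-mean of [c] minus the total mass 1
    of [p]. *)
Lemma kl_event_bound (T : finType) (p q : T -> R) (P : pred T) (n : nat) :
  (forall t, 0 < p t) -> (forall t, 0 < q t) ->
  \sum_t p t = 1 -> \sum_t q t = 1 -> \sum_(t | P t) q t <= 2^-1 ^+ n ->
  n%:R * ln 2 * (\sum_(t | P t) p t) <= \sum_t ln (p t / q t) * p t + 1.
Proof.
move=> p0 q0 p1 q1 qP.
(* The exponential of the test function [n * ln 2] times the indicator of [P]; the value [2 ^+ n] is
   the largest that the hypothesis on the [q]-mass of [P] compensates. *)
pose c t : R := if P t then 2 ^+ n else 1.
have c0 t : 0 < c t by rewrite /c; case: ifP => // _; rewrite exprn_gt0.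
have H : \sum_t (ln (c t) * p t + p t - c t * q t)
         <= \sum_t ln (p t / q t) * p t.
  by apply: ler_sum => t _; exact: ln_ratio_ge.
rewrite sumrB big_split /= p1 in H.
have E1 : \sum_t ln (c t) * p t = n%:R * ln 2 * \sum_(t | P t) p t.
  rewrite mulr_sumr [RHS]big_mkcond; apply: eq_bigr => t _; rewrite /c.
  by case: ifP => _; rewrite ?ln1 ?mul0r // lnXn // mulr_natl.
have E2 : \sum_t c t * q t <= 2.
  rewrite (_ : 2 = 1 + 1) // -{2}q1.
  (* Off [P] the weight is 1; enlarging that part to all of [T] costs at most the total mass 1 of
     [q]. *)
  apply: (@le_trans _ _ (2 ^+ n * (\sum_(t | P t) q t) + \sum_t q t)).
    rewrite mulr_sumr [X in _ <= X + _]big_mkcond -big_split.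
    apply: ler_sum => t _ /=; rewrite /c; have := q0 t.
    by case: ifP => _; nra.
  rewrite lerD2r; have := ler_wpM2l (ltW (exprn_gt0 n (ltr0Sn R 1))) qP.
  by rewrite -exprMn divff // expr1n.
rewrite E1 in H; lra.
Qed.

End KullbackLeibler.

(** * Transfer from finite levels to open sets of Cantor space *)

Section Cantor.
Context {R : realType}.
Implicit Types (nu mu : probability cantor R) (s : nat -> seq bool).

Lemma cylinder_take (s : seq bool) (w : cantor) N : (size s <= N)%N ->
  cylinder s w <-> take (size s) (restr w N) = s.
Proof.
by move=> sN; rewrite /cylinder /restr /= /mkseq -map_take take_iota (minn_idPl sN).
Qed.

(** The cylinders of length [N] partition the space, so the integrand is a finite combination of
    their indicators: at [w] only the term [t = restr w N] survives. *)
Lemma expectation_restr nu (f : seq bool -> R) N :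
  ('E_nu[fun w => f (restr w N)] =
   (\sum_(t : N.-tuple bool) f t * mass nu t)%:E)%E.
Proof.
have sR w : size (restr w N) == N by rewrite size_mkseq.
have mC (t : N.-tuple bool) : measurable (cylinder t).
  exact: cylinder_measurable.
rewrite unlock.
have -> : (\int[nu]_w (f (restr w N))%:E =
   \int[nu]_w \sum_(t : N.-tuple bool) ((f t)%:E * (\1_(cylinder t) w)%:E))%E.
  apply: eq_integral => w _; rewrite (bigD1 (Tuple (sR w))) //= big1 => [|t tw].
    rewrite adde0 indicE mem_set ?mule1 //.
    by rewrite /cylinder /= (eqP (sR w)).
  rewrite indicE memNset ?mule0 // /cylinder /= size_tuple => E.
  by case/negP: tw; apply/eqP/val_inj; rewrite /= E.
rewrite integral_sum //; last first.
  by move=> t; apply: integrableZl => //; exact: integrable_indic.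
rewrite -sumEFin; apply: eq_bigr => t _.
rewrite integralZl //; last exact: integrable_indic.
rewrite integral_indic // setIT EFinM /mass fineK //.
exact: fin_num_measure.
Qed.

Lemma sum_mass nu N : \sum_(t : N.-tuple bool) mass nu t = 1.
Proof.
apply: EFin_inj; have := expectation_restr nu (fun=> 1) N.
rewrite expectation_cst => ->; congr EFin.
by apply: eq_bigr => t _; rewrite mul1r.
Qed.

Lemma prob_restr nu (P : pred (seq bool)) N :
  measurable [set w : cantor | P (restr w N)] ->
  nu [set w : cantor | P (restr w N)] =
  (\sum_(t : N.-tuple bool | P t) mass nu t)%:E.
Proof.
move=> mP; rewrite -expectation_indic //.
rewrite (_ : \1_ _ = fun w => (P (restr w N))%:R) ?(expectation_restr nu (fun t => (P t)%:R)).
  congr EFin; rewrite [RHS]big_mkcond; apply: eq_bigr => t _.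
  by case: (P t); rewrite ?mul1r ?mul0r.
apply: funext => w; rewrite indicE; congr (_%:R); congr nat_of_bool.
by apply/idP/idP => [/set_mem|/mem_set].
Qed.

Lemma kl_finite_union_bound nu mu (D : R) s (m n : nat) :
  full_support nu -> full_support mu ->
  (forall N, ('E_nu[fun w => ln (mass nu (restr w N) / mass mu (restr w N))]
              <= D%:E)%E) ->
  (mu (\big[setU/set0]_(k < m) cylinder (s k)) <= (2^-1 ^+ n)%:E)%E ->
  ((n%:R * ln 2)%:E * nu (\big[setU/set0]_(k < m) cylinder (s k))
   <= (D + 1)%:E)%E.
Proof.
move=> pnu pmu klD.
(* At this level every cylinder of the union is decided by the first [N] bits, so the union becomes
   an event [P] on strings of length [N], and full support supplies the positivity required by
   [kl_event_bound]. *)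
set N := (\max_(k < m) size (s k))%N.
pose P (t : seq bool) := [exists k : 'I_m, take (size (s k)) t == s k].
have mU : measurable (\big[setU/set0]_(k < m) cylinder (s k)).
  by apply: bigsetU_measurable => k _; exact: cylinder_measurable.
have UE : \big[setU/set0]_(k < m) cylinder (s k) =
          [set w : cantor | P (restr w N)].
  rewrite -(bigcup_mkord _ (fun k => cylinder (s k))).
  apply/seteqP; split => w /=.
    move=> [k /= km sw]; apply/existsP; exists (Ordinal km); apply/eqP.
    apply/cylinder_take => //.
    exact: (@leq_bigmax _ (fun k : 'I_m => size (s k)) (Ordinal km)).
  move=> /existsP[k /eqP sw]; exists k => //=.
  apply/cylinder_take; last exact: sw.
  exact: (@leq_bigmax _ (fun k : 'I_m => size (s k)) k).
rewrite UE in mU *; rewrite !prob_restr // -EFinM !lee_fin => muP.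
apply: le_trans (kl_event_bound _ _ _ _ _ (fun t : N.-tuple bool => pnu t)
  (fun t : N.-tuple bool => pmu t) (sum_mass nu N) (sum_mass mu N) muP) _.
rewrite lerD2r -lee_fin.
by rewrite -(expectation_restr nu (fun t => ln (mass nu t / mass mu t))).
Qed.

Lemma kl_union_bound nu mu (D : R) s (n : nat) :
  full_support nu -> full_support mu ->
  (forall N, ('E_nu[fun w => ln (mass nu (restr w N) / mass mu (restr w N))]
              <= D%:E)%E) ->
  (mu (\bigcup_k cylinder (s k)) <= (2^-1 ^+ n)%:E)%E ->
  ((n%:R * ln 2)%:E * nu (\bigcup_k cylinder (s k)) <= (D + 1)%:E)%E.
Proof.
move=> pnu pmu klD muU.
have mC k : measurable (cylinder (s k)) by exact: cylinder_measurable.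
have mV m : measurable (\big[setU/set0]_(k < m) cylinder (s k)).
  exact: bigsetU_measurable.
have mU : measurable (\bigcup_k cylinder (s k)) by exact: bigcupT_measurable.
(* The bound [m.+1] matches the form of [bigcup_bigsetU_bigcup]. The finite bound does not depend on
   [m], so it survives continuity from below. *)
pose V m := \big[setU/set0]_(k < m.+1) cylinder (s k).
have UV : \bigcup_k cylinder (s k) = \bigcup_m V m.
  by rewrite -(bigcup_bigsetU_bigcup (fun k => cylinder (s k))).
have cV : nu (V m) @[m --> \oo] --> nu (\bigcup_k cylinder (s k)).
  rewrite UV; apply: nondecreasing_cvg_mu => //; first by move=> m; exact: mV.
    by rewrite -UV.
  move=> i j ij; apply/subsetPset.
  exact: (@subset_bigsetU _ (fun k => cylinder (s k)) i.+1 j.+1).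
have cVn := cvgeZl (isT : (n%:R * ln 2 : R)%:E \is a fin_num) cV.
rewrite -(cvg_lim _ cVn) //; apply: lime_le; first by apply/cvg_ex; eexists; exact: cVn.
apply: nearW => m; apply: (@kl_finite_union_bound _ mu) => //.
apply: le_trans muU; apply: le_measure; rewrite ?inE //.
exact: bigsetU_bigcup.
Qed.

End Cantor.

Theorem proposition1p17 (R : realType) (nu mu : probability cantor R)
  (hnu : computable_measure nu) (hmu : computable_measure mu)
  (snu : full_support nu) (smu : full_support mu)
  (hkl : kl_ac nu mu) : mlr_ac nu mu.
Proof.
move=> w nuw U [[s cs UE] muU] Uw.
move: hkl; rewrite /kl_ac; set S := ereal_sup _ => hkl.
(* Since [S] is finite by [hkl], [fine] loses nothing and [D] bounds the divergence at every
   level. *)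
pose D := fine S.
have klD N : ('E_nu[fun w => ln (mass nu (restr w N) / mass mu (restr w N))]
    <= D%:E)%E.
  by rewrite fineK //; apply: ereal_sup_ubound; exists N.
have ln2 : 0 < ln 2 :> R by rewrite ln_gt0 // ltr1n.
(* The Archimedean bound gives [D + 1 <= K * ln 2]; the successor makes [K] visibly positive, so
   that [K * ln 2] can be cancelled at the end. *)
pose K := (Num.bound `|(D + 1) / ln 2|).+1.
have DK : D + 1 <= K%:R * ln 2.
  rewrite -ler_pdivrMr //; apply: le_trans (ler_norm _) _.
  apply: le_trans (ltW (archi_boundP (normr_ge0 _))) _.
  by rewrite ler_nat.
(* A point in every [U n] lies in every member of the subsequence, so it remains to see that the
   subsequence is a [nu]-test. *)
apply: (nuw (fun n => U (K * 2 ^ n)%N)); last by move=> n _; exact: Uw.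
split.
  exists (fun n k => s (K * 2 ^ n)%N k); last by move=> n; exact: UE.
  exact: (recursive2_compl _ (fun n => (K * 2 ^ n)%N) cs (recursive_mul_expn2 K)).
move=> n; have := muU (K * 2 ^ n)%N; rewrite UE => /(kl_union_bound _ _ _ _ _ snu smu klD).
have mU : measurable (\bigcup_k cylinder (s (K * 2 ^ n)%N k)).
  by apply: bigcupT_measurable => k; exact: cylinder_measurable.
rewrite -(fineK (fin_num_measure nu _ mU)) -EFinM !lee_fin.
set x := fine _ => /le_trans/(_ DK).
have K0 : 0 < K%:R * ln 2 :> R by rewrite mulr_gt0 // ltr0n.
(* Cancelling [K * ln 2] on both sides leaves [2 ^+ n * x <= 1], which is the required test
   bound. *)
rewrite natrM natrX (_ : _ * _ * _ * x = K%:R * ln 2 * (2 ^+ n * x)); last by ring.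
rewrite -[leRHS]mulr1 ler_pM2l // exprVn => H.
by rewrite -[leRHS]mul1r ler_pdivlMr ?exprn_gt0 // mulrC.
Qed.
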